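(* Let $p$ be a prime, let $r,s\ge0$ be integers, and let $q=p^r$. Then $\mathsf{D}_{p^s}(\mathbb{Z}_q)=p^{r+s}$.
   Context: For a finite commutative ring $A$, a sequence over $A$ is a finite multiset $S=(a_1,\dots,a_\ell)$ of elements of $A$ (order disregarded, repetition allowed); its length $|S|=\ell$ counts multiplicity, and a subsequence is a sub-multiset. For an integer $m\ge1$ set $e_m(S)=\sum_{1\le i_1<\dots<i_m\le \ell}\prod_{j=1}^m a_{i_j}$. $\mathsf{D}_m(A)$ denotes the smallest positive integer $t$ such that every sequence $S$ over $A$ with $|S|\ge t$ contains a subsequence $S'$ with $|S'|\ge m$ and $e_m(S')=0$. $\mathbb{Z}_q$ is the ring of integers modulo $q$. *)

(* Defs.v *)
From HB Require Import structures.
From mathcomp Require Import all_boot all_order all_algebra.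
From mathcomp Require Import finmap multiset.

Set Implicit Arguments.
Unset Strict Implicit.
Unset Printing Implicit Defensive.

Import GRing.Theory.
Local Open Scope ring_scope.

(* The ring of integers modulo q, for every q >= 1. The library's 'Z_q is not
   usable here: 'Z_1 is Z/2, whereas intmod 1 is the zero ring (hence the
   structures on possibly trivial rings). As q.-1.+1 = q only for q > 0, the
   value intmod 0 = 'I_1 is junk. *)
Definition intmod (q : nat) : Type := 'I_q.-1.+1.

HB.instance Definition _ (q : nat) := Finite.copy (intmod q) 'I_q.-1.+1.
HB.instance Definition _ (q : nat) := GRing.Zmodule.copy (intmod q) 'I_q.-1.+1.

Fact intmod_mulA (q : nat) : associative (@Zp_mul q.-1.+1 : intmod q -> _).
Proof. exact: Zp_mulA. Qed.

Fact intmod_mulC (q : nat) : commutative (@Zp_mul q.-1.+1 : intmod q -> _).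
Proof. exact: Zp_mulC. Qed.

Fact intmod_mul1 (q : nat) :
  left_id (Zp1 : intmod q) (@Zp_mul q.-1.+1 : intmod q -> _).
Proof. exact: Zp_mul1z. Qed.

Fact intmod_mulDl (q : nat) :
  left_distributive (@Zp_mul q.-1.+1 : intmod q -> _) (@GRing.add (intmod q)).
Proof. exact: Zp_mul_addl. Qed.

HB.instance Definition _ (q : nat) :=
  GRing.Zmodule_isComPzRing.Build (intmod q)
    (@intmod_mulA q) (@intmod_mulC q) (@intmod_mul1 q) (@intmod_mulDl q).

Lemma card_intmod (q : nat) : (0 < q)%N -> #|{: intmod q}| = q.
Proof. by move=> q_gt0; rewrite card_ord prednK. Qed.

Lemma val_intmodD (q : nat) (x y : intmod q) : (0 < q)%N ->
  nat_of_ord (x + y) = ((nat_of_ord x + nat_of_ord y) %% q)%N.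
Proof. by case: q x y. Qed.

Lemma val_intmodM (q : nat) (x y : intmod q) : (0 < q)%N ->
  nat_of_ord (x * y) = ((nat_of_ord x * nat_of_ord y) %% q)%N.
Proof. by case: q x y. Qed.

(* A finite multiset S coerces to an enumeration of its elements, repeated
   according to multiplicity; size S is thus its length. Increasing m-tuples of
   indices are encoded as m-element sets of positions in that enumeration. *)
Definition elemsym (A : finComPzRingType) (m : nat) (S : {mset A}%mset) : A :=
  \sum_(I : {set 'I_(size S)} | #|I| == m) \prod_(i in I) S`_i.

Definition forces_elemsym0 (A : finComPzRingType) (m t : nat) : Prop :=
  forall S : {mset A}%mset, (t <= size S)%N ->
    exists S' : {mset A}%mset,
      [/\ (S' `<=` S)%mset, (m <= size S')%N & elemsym m S' = 0].

(* The graph of (A, m) |-> D_m(A): t is the smallest positive integer that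
   forces a subsequence of length at least m on which e_m vanishes. *)
Definition is_D (A : finComPzRingType) (m t : nat) : Prop :=
  [/\ (0 < t)%N, forces_elemsym0 A m t &
      forall u : nat, (0 < u)%N -> forces_elemsym0 A m u -> (t <= u)%N].

(* Main.v *)
Require Import Defs.
From mathcomp Require Import all_boot all_order all_algebra.
From mathcomp Require Import finmap multiset ring.

Set Implicit Arguments.
Unset Strict Implicit.
Unset Printing Implicit Defensive.

Import GRing.Theory.
Local Open Scope ring_scope.

(* Lower bound: over a sequence of k ones, e_(p^s) takes the value C(k, p^s),
   whose p-adic valuation is that of floor(k / p^s), hence less than r when
   p^s <= k < p^(r+s).

   Upper bound: for q = p^r, the function n |-> sum_(j < q) (-1)^j C(n, j) is
   modulo p the indicator of q | n. Applied to f(x) = e_(p^s) of the subsequence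
   indexed by x, lifted to the natural numbers, it yields a polynomial in the
   indicator variables of x of degree at most (q - 1) p^s; applied with p^s for
   q to |x|, one of degree at most p^s - 1. Their product has degree less than
   p^(r+s) <= |S|, so its alternating sum over all x vanishes modulo p. As x = 0 (empty)
   contributes 1, some nonempty x has p^s | |x| and q | f(x). *)

(** * Divisibility by powers of $p$ *)

Lemma logn_addMX (p s a c : nat) : prime p -> (0 < c < p ^ s)%N ->
  logn p (a * p ^ s + c) = logn p c.
Proof.
move=> p_pr /andP[c_gt0 c_lt].
have [c' p_c' Dc] := pfactor_coprime p_pr c_gt0.
set e := logn p c in Dc *.
have c'_gt0 : (0 < c')%N by move: c_gt0; rewrite Dc muln_gt0 => /andP[].
have e_lt : (e < s)%N.
  rewrite -(ltn_exp2l _ _ (prime_gt1 p_pr)); apply: leq_ltn_trans c_lt.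
  by rewrite Dc leq_pmull.
(* As $e < s$, taking out $p^e$ leaves a multiple of $p$ plus the $p$-free part [c']. *)
have -> : (a * p ^ s + c = p ^ e * (a * p ^ (s - e) + c'))%N.
  by rewrite Dc mulnDr mulnCA -expnD subnKC ?(ltnW e_lt) // (mulnC c').
rewrite lognM ?expn_gt0 ?(prime_gt0 p_pr) ?addn_gt0 ?c'_gt0 ?orbT //.
rewrite pfactorK // [X in (_ + X)%N]logn_coprime ?addn0 //.
move: p_c'; rewrite -(subnSK e_lt) expnS mulnCA.
by rewrite !prime_coprime // dvdn_addr // dvdn_mulr.
Qed.

(** In $i\,C(p^r,i) = p^r C(p^r-1,i-1)$, if $p$ did not divide $C(p^r,i)$ then $p^r$ would divide
    $i$, which is too small. *)
Lemma dvdn_bin_pX (p r i : nat) : prime p -> (0 < i < p ^ r)%N ->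
  (p %| 'C(p ^ r, i))%N.
Proof.
case: i => // i p_pr i_lt; apply: contraLR (i_lt) => p_ndvd.
rewrite /= -leqNgt dvdn_leq //.
rewrite -(@Gauss_dvdl _ _ 'C(p ^ r, i.+1)); last first.
  by rewrite coprimeXl // prime_coprime.
by rewrite -mul_bin_diag dvdn_mulr.
Qed.

(** * Alternating binomial sums and the valuation of $C(k,p^s)$ *)

Section AlternatingBinomialSum.

Variable p : nat.
Hypothesis p_pr : prime p.

Definition altbin (q n : nat) : 'F_p := \sum_(j < q) (-1) ^+ j * 'C(n, j)%:R.

Lemma natF_eq0 (n : nat) : (n%:R == 0 :> 'F_p) = (p %| n)%N.
Proof. by rewrite (dvdn_pcharf (pchar_Fp p_pr)). Qed.

(** Pascal's rule makes the sum telescope. *)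
Lemma altbinSS (q n : nat) : altbin q.+1 n.+1 = (-1) ^+ q * 'C(n, q)%:R.
Proof.
elim: q => [|q IHq]; first by rewrite /altbin big_ord1 !bin0.
rewrite /altbin big_ord_recr /= -/(altbin _ _) IHq binS natrD exprS.
by ring.
Qed.

Lemma altbin0 (q : nat) : (0 < q)%N -> altbin q 0 = 1.
Proof.
case: q => // q _; rewrite /altbin big_ord_recl bin0 mul1r big1 ?addr0 // => i _.
by rewrite bin0n mulr0.
Qed.

Lemma altbin_small (q n : nat) : (0 < n < q)%N -> altbin q n = 0.
Proof. by case: q n => [|q] [|n] // n_lt; rewrite altbinSS bin_small ?mulr0. Qed.

(** In Vandermonde's expansion of $C(p^r+n,j)$ with $j<p^r$, every term but the one with $C(p^r,0)$
    vanishes modulo $p$. *)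
Lemma altbinD (r n : nat) : altbin (p ^ r) (n + p ^ r) = altbin (p ^ r) n.
Proof.
apply: eq_bigr => j _; congr (_ * _); rewrite addnC -binomial.Vandermonde.
rewrite big_ord_recl natrD bin0 mul1n subn0 natr_sum big1 ?addr0 // => i _.
apply/eqP; rewrite natF_eq0 dvdn_mulr // dvdn_bin_pX //=.
exact: leq_ltn_trans (ltn_ord i) (ltn_ord j).
Qed.

Lemma altbinE (r n : nat) : altbin (p ^ r) n = (p ^ r %| n)%:R.
Proof.
have q_gt0 : (0 < p ^ r)%N by rewrite expn_gt0 prime_gt0.
rewrite {1}(divn_eq n (p ^ r)) /dvdn; elim: (n %/ _)%N => [|k <-]; last first.
  by rewrite mulSn -addnA addnC altbinD.
rewrite add0n; case: eqP => [->|/eqP n_neq0]; first exact: altbin0.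
by rewrite altbin_small // lt0n n_neq0 ltn_pmod.
Qed.

(** Induction on $b$: with $n=am+b+1$, one has $(n-m)C(n,m)=n\,C(n-1,m)$, where $n-m$ and $n$ both
    have the valuation of $b+1<m$. For $b=0$, use $C(am,m)=a\,C(am-1,m-1)$. *)
Lemma logn_bin_pX (s a b : nat) : (0 < a)%N -> (b < p ^ s)%N ->
  logn p 'C(a * p ^ s + b, p ^ s) = logn p a.
Proof.
set m := (p ^ s)%N => a_gt0.
have m_gt0 : (0 < m)%N by rewrite expn_gt0 prime_gt0.
have m_le b' : (m <= a * m + b')%N by rewrite (leq_trans (leq_pmull m a_gt0)) ?leq_addr.
elim: b => [_|b IHb b_lt].
  rewrite addn0; have am_gt0 : (0 < a * m)%N by rewrite muln_gt0 a_gt0.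
  (* Up to sign this binomial is [altbin] $m$ at $am$, which is 1 modulo $p$. *)
  have p_ndvd : ~~ (p %| 'C((a * m).-1, m.-1))%N.
    rewrite -natF_eq0; apply/eqP => bin0; have := altbinE s (a * m)%N.
    rewrite -/m -[X in altbin X](prednK m_gt0) -[X in altbin _ X](prednK am_gt0).
    by rewrite altbinSS bin0 mulr0 dvdn_mull // => /eqP; rewrite eq_sym oner_eq0.
  have : (m * (a * 'C((a * m).-1, m.-1)) = m * 'C(a * m, m))%N.
    by rewrite mulnA (mulnC m) mul_bin_diag prednK.
  move/eqP; rewrite eqn_pmul2l // => /eqP <-.
  have bin_am_gt0 : (0 < 'C((a * m).-1, m.-1))%N.
    by rewrite lt0n; apply: contraNneq p_ndvd => ->.
  by rewrite lognM // [X in (_ + X)%N]logn_coprime ?addn0 // prime_coprime.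
have m_lt : (m < a * m + b.+1)%N by rewrite addnS ltnS.
have /(congr1 (logn p)) := mul_bin_down (a * m + b.+1) m.
rewrite addnS /= -addnS !lognM ?bin_gt0 ?subn_gt0 ?addn_gt0 ?orbT //.
have -> : (a * m + b.+1 - m = a.-1 * m + b.+1)%N.
  by case: a a_gt0 {m_le m_lt IHb} => //= a _; rewrite mulSn -addnA addKn.
by rewrite !logn_addMX // (IHb (ltnW b_lt)) => /addnI <-.
Qed.

Lemma ndvdn_bin_pX (r s k : nat) : (p ^ s <= k < p ^ (r + s))%N ->
  ~~ (p ^ r %| 'C(k, p ^ s))%N.
Proof.
have m_gt0 : (0 < p ^ s)%N by rewrite expn_gt0 prime_gt0.
move=> /andP[k_ge k_lt]; rewrite pfactor_dvdn ?bin_gt0 // -ltnNge.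
rewrite (divn_eq k (p ^ s)) logn_bin_pX ?ltn_pmod ?divn_gt0 //.
rewrite -(ltn_exp2l _ _ (prime_gt1 p_pr)).
apply: leq_ltn_trans (_ : k %/ p ^ s < _)%N; last by rewrite ltn_divLR // -expnD.
by rewrite dvdn_leq ?divn_gt0 // pfactor_dvdnn.
Qed.

End AlternatingBinomialSum.

(** * Polynomial functions on $\{0,1\}^I$ and their degrees *)

Section SetPolynomials.

Variables (I : finType) (R : comPzRingType).
Implicit Types (g h : {set I} -> R) (x T : {set I}) (d : nat).

(* Subsets of I are the points of {0,1}^I, and the indicator of T \subset x is
   the monomial prod_(i in T) x_i. *)
Definition deg_le d g : Prop :=
  exists2 c : seq (R * {set I}), all (fun t : R * {set I} => #|t.2| <= d)%N c &
    forall x, g x = \sum_(t <- c) t.1 * (t.2 \subset x)%:R.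

Lemma eq_deg_le d g h : g =1 h -> deg_le d g -> deg_le d h.
Proof. by move=> eq_gh [c c_d Dg]; exists c => // x; rewrite -eq_gh. Qed.

Lemma deg_leW d d' g : (d <= d')%N -> deg_le d g -> deg_le d' g.
Proof.
move=> le_dd' [c c_d Dg]; exists c => //.
by apply: sub_all c_d => t /leq_trans; apply.
Qed.

Lemma deg_le0 d : deg_le d (fun=> 0).
Proof. by exists [::] => // x; rewrite big_nil. Qed.

Lemma deg_le_monomial T : deg_le #|T| (fun x => (T \subset x)%:R).
Proof. by exists [:: (1, T)] => [|x]; rewrite /= ?leqnn // big_seq1 mul1r. Qed.

Lemma deg_leD d g h : deg_le d g -> deg_le d h -> deg_le d (fun x => g x + h x).
Proof.
move=> [c c_d Dg] [c' c'_d Dh]; exists (c ++ c'); first by rewrite all_cat c_d.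
by move=> x; rewrite big_cat Dg Dh.
Qed.

Lemma deg_le_sum d (K : Type) (s : seq K) (g : K -> {set I} -> R) :
  (forall k, deg_le d (g k)) -> deg_le d (fun x => \sum_(k <- s) g k x).
Proof.
move=> g_d; elim: s => [|k s IHs].
  by apply: eq_deg_le (deg_le0 d) => x; rewrite big_nil.
by apply: eq_deg_le (deg_leD (g_d k) IHs) => x; rewrite big_cons.
Qed.

Lemma deg_leM d d' g h :
  deg_le d g -> deg_le d' h -> deg_le (d + d') (fun x => g x * h x).
Proof.
move=> [c /allP c_d Dg] [c' /allP c'_d' Dh].
exists [seq (t.1 * u.1, t.2 :|: u.2) | t <- c, u <- c'].
  apply/allP => _ /allpairsP[[t u] [/= /c_d t_d /c'_d' u_d' ->]] /=.
  by rewrite (leq_trans (leq_card_setU _ _)) ?leq_add.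
move=> x; rewrite Dg Dh big_allpairs_dep /= big_distrlr /=.
apply: eq_bigr => t _; apply: eq_bigr => u _.
by rewrite subUset -mulnb natrM mulrACA.
Qed.

Lemma deg_leZ d a g : deg_le d g -> deg_le d (fun x => a * g x).
Proof.
apply: (@deg_leM 0 d (fun=> a)); exists [:: (a, set0)] => [|x].
  by rewrite /= cards0.
by rewrite big_seq1 sub0set mulr1.
Qed.

(** Each monomial misses some variable $i$; adding $i$ to $x$ or removing it flips the sign and
    keeps the monomial's value, so the terms cancel in pairs. *)
Lemma deg_le_sign_sum d g : deg_le d g -> (d < #|I|)%N ->
  \sum_(x : {set I}) (-1) ^+ #|x| * g x = 0.
Proof.
move=> [c /allP c_d Dg] d_lt.
under eq_bigr => x _ do rewrite Dg mulr_sumr.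
rewrite exchange_big big_seq big1 //= => t /c_d t_d.
have /subsetPn[i _ iNt] : ~~ (setT \subset t.2).
  by apply: contraL (leq_ltn_trans t_d d_lt) => /subset_leq_card; rewrite cardsT leqNgt.
rewrite (bigID (fun x : {set I} => i \in x)) /=.
rewrite (reindex_onto (fun x => i |: x) (fun x => x :\ i)) /=; last first.
  by move=> x; exact: setD1K.
rewrite [X in X + _](eq_bigl (fun x => i \notin x)); last first.
  move=> x; rewrite setU11 /=; apply/eqP/idP => [<-|]; first by rewrite setD11.
  exact: setU1K.
rewrite -big_split big1 //= => x iNx.
rewrite cardsU1 iNx exprS -subDset (_ : t.2 :\: [set i] = t.2) ?mulN1r ?mulNr ?addNr //.
by apply/setDidPl; rewrite disjoint_sym disjoints1.
Qed.

(* f behaves like a polynomial of degree d whose binomials C(f, j) make sense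
   in R even when j! is not invertible there. *)
Definition bin_deg_le d (f : {set I} -> nat) : Prop :=
  forall j, deg_le (j * d) (fun x => 'C(f x, j)%:R).

Lemma bin_deg_le0 d : bin_deg_le d (fun=> 0%N).
Proof.
case=> [|j]; last exact: deg_le0.
have := deg_le_monomial set0; rewrite cards0; apply: eq_deg_le => x.
by rewrite sub0set.
Qed.

(** An indicator takes only the values 0 and 1, so its binomials with $j\ge2$ vanish. *)
Lemma bin_deg_le_monomial d T : (#|T| <= d)%N ->
  bin_deg_le d (fun x => (T \subset x)).
Proof.
move=> T_d [|[|j]].
- by apply: eq_deg_le (bin_deg_le0 d 0) => x; rewrite !bin0.
- rewrite mul1n; apply: deg_leW T_d _; apply: eq_deg_le (deg_le_monomial T).
  by move=> x; rewrite bin1.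
- by apply: eq_deg_le (deg_le0 _) => x; case: (T \subset x).
Qed.

Lemma bin_deg_leD d f f' : bin_deg_le d f -> bin_deg_le d f' ->
  bin_deg_le d (fun x => f x + f' x)%N.
Proof.
move=> f_d f'_d j.
have: deg_le (j * d)
    (fun x => \sum_(i < j.+1) 'C(f x, i)%:R * 'C(f' x, j - i)%:R).
  apply: deg_le_sum => i; apply: deg_leW (deg_leM (f_d i) (f'_d (j - i)%N)).
  by rewrite -mulnDl subnKC // -ltnS.
apply: eq_deg_le => x; rewrite -binomial.Vandermonde natr_sum.
by apply: eq_bigr => i _; rewrite natrM.
Qed.

Lemma bin_deg_le_sum d (K : eqType) (s : seq K) (w : K -> nat)
    (f : K -> {set I} -> nat) : {in s, forall k, bin_deg_le d (f k)} ->
  bin_deg_le d (fun x => \sum_(k <- s) w k * f k x)%N.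
Proof.
elim: s => [|k s IHs] s_d j.
  by apply: eq_deg_le (bin_deg_le0 d j) => x; rewrite big_nil.
have /IHs{}IHs : {in s, forall k, bin_deg_le d (f k)}.
  by move=> k' sk'; apply: s_d; rewrite inE sk' orbT.
have {s_d}k_d := s_d k (mem_head k s).
(* Natural weights act by repeated addition, so Vandermonde's identity covers them too. *)
have kn_d n : bin_deg_le d (fun x => n * f k x)%N.
  elim: n => [|n IHn] i.
    by apply: eq_deg_le (bin_deg_le0 d i) => x; rewrite mul0n.
  by apply: eq_deg_le (bin_deg_leD k_d IHn i) => x; rewrite mulSn.
by apply: eq_deg_le (bin_deg_leD (kn_d (w k)) IHs j) => x; rewrite big_cons.
Qed.

End SetPolynomials.

(** * The degree argument, for arbitrary natural weights *)

Lemma exists_set_dvd (I : finType) (p r s : nat) (w : {set I} -> nat) :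
    prime p -> (p ^ (r + s) <= #|I|)%N ->
  exists2 x : {set I}, (p ^ s <= #|x|)%N &
    (p ^ r %| \sum_(J : {set I} | (J \subset x) && (#|J| == p ^ s)) w J)%N.
Proof.
move=> p_pr card_I.
set m := (p ^ s)%N.
pose f (x : {set I}) := (\sum_(J : {set I} | (J \subset x) && (#|J| == m)) w J)%N.
have pX_gt0 n : (0 < p ^ n)%N by rewrite expn_gt0 prime_gt0.
have altbin_deg d n (h : {set I} -> nat) : bin_deg_le 'F_p d h ->
    deg_le ((p ^ n).-1 * d) (fun x => altbin p (p ^ n) (h x)).
  move=> h_d; apply: deg_le_sum => j; apply: deg_leZ; apply: deg_leW (h_d j).
  by rewrite leq_mul2r -ltnS prednK // ltn_ord orbT.
have f_d : bin_deg_le 'F_p m f.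
  have : bin_deg_le 'F_p m (fun x : {set I} =>
      \sum_(J <- [seq J <- index_enum {set I} | #|(J : {set I})| == m]) w J * (J \subset x))%N.
    apply: bin_deg_le_sum => J; rewrite mem_filter => /andP[/eqP <- _].
    exact: bin_deg_le_monomial.
  move=> h j; apply: eq_deg_le (h j) => x; rewrite big_filter /f.
  rewrite [in RHS]big_mkcondl /=; congr 'C(_, _)%:R; apply: eq_bigr => J _.
  by case: (J \subset x); rewrite ?muln1 ?muln0.
(* The cardinal is the sum of the singleton indicators. *)
have card_d : bin_deg_le 'F_p 1 (fun x : {set I} => #|x|).
  have : bin_deg_le 'F_p 1 (fun x : {set I} =>
      \sum_(i <- index_enum I) 1 * ([set i] \subset x))%N.
    by apply: bin_deg_le_sum => i _; apply: bin_deg_le_monomial; rewrite cards1.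
  move=> h j; apply: eq_deg_le (h j) => x; rewrite -sum1_card [in RHS]big_mkcond /=.
  by congr 'C(_, _)%:R; apply: eq_bigr => i _; rewrite sub1set mul1n; case: (i \in x).
have := deg_le_sign_sum (deg_leM (altbin_deg _ r _ f_d) (altbin_deg _ s _ card_d)).
(* The left side is $(p^r-1)p^s+p^s-1=p^{r+s}-1$. *)
have deg_lt : ((p ^ r).-1 * m + (p ^ s).-1 * 1 < #|I|)%N.
  apply: leq_trans card_I; rewrite muln1 -addnS prednK // expnD -/m.
  by rewrite addnC -mulSn prednK.
move=> /(_ deg_lt) sum0.
have [/existsP[x /andP[]]|/existsPn noset] :=
  boolP [exists x : {set I}, (m <= #|x|)%N && (p ^ r %| f x)%N]; first by exists x.
(* If no set works, only the empty one contributes: it gives 1, since $m>0$ forces $f(\emptyset)=0$.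
   A nonempty $x$ with $p^s$ dividing $|x|$ has $|x|\ge p^s$, so it is excluded by [noset]. *)
move/eqP: sum0; rewrite (bigD1 set0) //= big1 ?addr0 => [|x x_neq0].
  rewrite !altbinE // cards0 dvdn0 mulr1 mul1r.
  rewrite /f big1 ?dvdn0 ?oner_eq0 // => J /andP[].
  rewrite subset0 => /eqP -> /eqP; rewrite cards0 => m0.
  by have := pX_gt0 s; rewrite -/m -m0.
have := noset x; rewrite !altbinE // -natrM mulnb.
have [m_dvd | _] := boolP (p ^ s %| #|x|)%N; last by rewrite andbF mulr0.
by rewrite dvdn_leq ?card_gt0 //= => /negPf ->; rewrite mulr0.
Qed.

(** * From sets of positions to submultisets *)

Lemma perm_map_exists (T U : eqType) (f : T -> U) (s : seq T) (t : seq U) :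
  perm_eq t (map f s) -> exists2 e, perm_eq e s & t = map f e.
Proof.
elim: t s => [|a t IHt] s.
  by rewrite perm_sym => /perm_nilP; case: s => // _; exists [::].
move=> perm_t; have /mapP[i s_i Da] : a \in map f s.
  by rewrite -(perm_mem perm_t) mem_head.
have perm_s := perm_to_rem s_i.
have /IHt[e perm_e Dt] : perm_eq t (map f (rem i s)).
  by have := perm_trans perm_t (perm_map f perm_s); rewrite /= -Da perm_cons.
exists (i :: e); last by rewrite /= -Da Dt.
by rewrite perm_sym (perm_trans perm_s) // perm_cons perm_sym.
Qed.

Lemma sum_elemsym_map (I : finType) (A : comPzRingType) (F : I -> A)
    (e : seq I) (m : nat) : uniq e ->
  \sum_(K : {set 'I_(size (map F e))} | #|K| == m) \prod_(k in K) (map F e)`_k =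
  \sum_(J : {set I} | (J \subset e) && (#|J| == m)) \prod_(j in J) F j.
Proof.
(* As [e] has no repetition, [phi] matches positions in [e] bijectively with its entries; $J$ is the
   image of $K$. *)
move=> e_uniq; pose phi k := tnth (in_tuple e) (cast_ord (size_map F e) k).
have phi_inj : injective phi.
  by move=> k l /(tuple_uniqP (in_tuple e) e_uniq)/cast_ord_inj.
have phiE (k : 'I_(size (map F e))) : (map F e)`_k = F (phi k).
  have k_lt : (k < size e)%N by rewrite -(size_map F e).
  by rewrite (nth_map (phi k)) // [in RHS]/phi (tnth_nth (phi k)).
rewrite [RHS](reindex_onto (fun K : {set _} => phi @: K) (fun J => phi @^-1: J)) /=.
  apply: eq_big => [K | K _].
    rewrite card_imset // (_ : phi @^-1: _ = K) ?eqxx ?andbT; last first.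
      by apply/setP => k; rewrite inE mem_imset.
    rewrite andbC; case: eqP => //= _; apply/esym/subsetP => _ /imsetP[k _ ->].
    exact: mem_tnth.
  by rewrite big_imset /= => [|? ? _ _ /phi_inj //]; apply: eq_bigr => k _.
move=> J /andP[/subsetP J_e _]; apply/setP => j; apply/imsetP/idP => [[k + ->]|J_j].
  by rewrite inE.
have /(tnthP (in_tuple e))[k Dj] := J_e j J_j.
exists (cast_ord (esym (size_map F e)) k); last by rewrite /phi cast_ordKV.
by rewrite inE /phi cast_ordKV -Dj.
Qed.

(** [seq_mset] may enumerate its elements in another order; [perm_map_exists] lifts that order to a
    permutation [e] of the positions in [x]. *)
Lemma elemsym_sub (A : finComPzRingType) (S : {mset A}%mset)
    (x : {set 'I_(size S)}) (m : nat) :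
  elemsym m (seq_mset [seq S`_i | i : 'I_(size S) <- enum x]) =
  \sum_(J : {set 'I_(size S)} | (J \subset x) && (#|J| == m)) \prod_(j in J) S`_j.
Proof.
rewrite /elemsym.
have [e perm_e ->] := perm_map_exists (perm_eq_seq_mset [seq S`_i | i : 'I__ <- enum x]).
rewrite sum_elemsym_map ?(perm_uniq perm_e) ?enum_uniq //.
apply: eq_bigl => J; congr (_ && _); apply: eq_subset_r => i.
by rewrite (perm_mem perm_e) mem_enum.
Qed.

Lemma count_mem_mset (A : choiceType) (a : A) (S : {mset A}%mset) :
  count_mem a S = S a.
Proof. by rewrite -mset_seqE seq_mset_id. Qed.

Lemma msubset_sub (A : choiceType) (a0 : A) (S : {mset A}%mset)
    (x : {set 'I_(size S)}) :
  (seq_mset [seq nth a0 S i | i : 'I_(size S) <- enum x] `<=` S)%mset.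
Proof.
apply/msubsetP => a; rewrite mset_seqE -count_mem_mset.
have Senum : [seq nth a0 S i | i : 'I_(size S) <- enum 'I_(size S)] = S.
  by rewrite -[RHS](mkseq_nth a0) /mkseq -val_enum_ord -map_comp.
rewrite -[X in (_ <= count_mem a X)%N]Senum !count_map; apply: leq_count_subseq.
exact: filter_subseq.
Qed.

(** * Residues modulo $q$ and the two bounds *)

Lemma val_intmod_nat (q n : nat) : (0 < q)%N ->
  nat_of_ord (n%:R : intmod q) = (n %% q)%N.
Proof.
move=> q_gt0; elim: n => [|n IHn]; first by rewrite mod0n.
rewrite -natr1 val_intmodD // IHn.
(* The form [1 %% q] includes the zero ring $q=1$, where it is 0. *)
have -> : nat_of_ord (1 : intmod q) = (1 %% q)%N by case: q q_gt0 {IHn}.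
by rewrite modnDm addn1.
Qed.

Lemma intmod_natK (q : nat) (a : intmod q) : (0 < q)%N -> (nat_of_ord a)%:R = a.
Proof.
move=> q_gt0; apply: val_inj; rewrite /= val_intmod_nat // modn_small //.
by rewrite -[X in (_ < X)%N](prednK q_gt0) ltn_ord.
Qed.

Lemma intmod_nat_eq0 (q n : nat) : (0 < q)%N ->
  (n%:R = 0 :> intmod q) <-> (q %| n)%N.
Proof.
move=> q_gt0; split=> [/(congr1 val)/= | /eqP q_n].
  by rewrite val_intmod_nat // => /eqP.
by apply: val_inj; rewrite /= val_intmod_nat.
Qed.

Lemma elemsym_ones (A : finComPzRingType) (m : nat) (S : {mset A}%mset) :
  {in S, forall a, a = 1} -> elemsym m S = 'C(size S, m)%:R.
Proof.
move=> S1; rewrite /elemsym; under eq_bigr => K _.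
  rewrite big1 => [|k _]; last by apply: S1; rewrite mem_nth.
  over.
rewrite sumr_const -[in RHS](card_ord (size S)) -card_draws.
by congr (_ *+ _); apply: eq_card => K; rewrite inE.
Qed.

Theorem theorem8 (p r s q : nat) (hp : prime p) (hq : q = (p ^ r)%N) :
  is_D (intmod q) (p ^ s)%N (p ^ (r + s))%N.
Proof.
have q_gt0 : (0 < q)%N by rewrite hq expn_gt0 prime_gt0.
split; first by rewrite expn_gt0 prime_gt0.
  move=> S S_size.
  have card_I : (p ^ (r + s) <= #|'I_(size S)|)%N by rewrite card_ord.
  (* Products of the canonical representatives: their sum over the $J$ inside $x$ reduces modulo $q$
     to $e_{p^s}$ of the subsequence. *)
  pose w (J : {set 'I_(size S)}) := (\prod_(j in J) nat_of_ord (S`_j)%R)%N.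
  have [x x_card x_dvd] := exists_set_dvd w hp card_I.
  exists (seq_mset [seq S`_i | i : 'I_(size S) <- enum x]); split.
  - exact: msubset_sub.
  - by rewrite (perm_size (perm_eq_seq_mset _)) size_map -cardE.
  - move: x_dvd; rewrite -hq elemsym_sub => /(intmod_nat_eq0 _ q_gt0) x0.
    rewrite -[RHS]x0 natr_sum; apply: eq_bigr => J _; rewrite natr_prod.
    by apply: eq_bigr => j _; rewrite intmod_natK.
move=> u u_gt0 u_forces; rewrite leqNgt; apply/negP => u_lt.
(* Any subsequence of $u<p^{r+s}$ ones consists of $k\le u$ ones. *)
have [|S [S_sub S_size S_eq0]] := u_forces (msetn u (1 : intmod q)).
  by rewrite enum_msetn size_nseq.
have S1 : {in S, forall a, a = 1}.
  move=> a; rewrite -mset_neq0 => Sa; apply/eqP; move/msubsetP/(_ a): S_sub.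
  by rewrite msetnE; case: eqP => //; rewrite leqn0 (negPf Sa).
have S_le : (size S <= u)%N.
  have <- : count_mem (1 : intmod q) S = size S.
    by apply/eqP; rewrite -all_count; apply/allP => a /S1 ->; exact: eqxx.
  by have /msubsetP/(_ 1) := S_sub; rewrite msetnxx -count_mem_mset.
move: S_eq0; rewrite elemsym_ones // => /(intmod_nat_eq0 _ q_gt0).
move: (size S) S_size S_le => k k_ge k_le.
by apply/negP; rewrite hq ndvdn_bin_pX // k_ge (leq_ltn_trans k_le).
Qed.
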